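(* Let $u,v,w\in W$ and let $\boldsymbol{v}=(s_1,\ldots,s_n)$ be a reduced expression for $v$. Then $$c_{u,v}^w=\sum_{\gamma\in\mathcal{P}(w,\boldsymbol{v})_u}q(\gamma).$$
   Context: $(W,S)$ is a Coxeter system with $S$ finite and length function $\ell$. $X$ is a locally finite regular building of type $(W,S)$ with chamber set $\mathcal{C}$ and Weyl distance $\delta$; regularity means each panel of cotype $\{s\}$ lies in exactly $q_s+1$ chambers. For $c\in\mathcal{C}$, $x\in W$, $\mathcal{C}_x(c)=\{d\in\mathcal{C}:\delta(c,d)=x\}$; it is known that $|\mathcal{C}_u(a)\cap\mathcal{C}_v(b)|$ depends only on $u,v$ and $w=\delta(a,b)$, and this number is denoted $c_{u,v}^w$. A pointed pregallery of type $(s_1,\ldots,s_n)$ (in the Coxeter complex) is a sequence $\gamma=(w_0,s_1,w_1,\ldots,s_n,w_n)$ with $w_j\in W$, $s_j\in S$, such that $w_j\in\{w_{j-1},w_{j-1}s_j\}$ for each $j$, and if $w_{j-1}=w_j$ then $\ell(w_{j-1}s_j)<\ell(w_{j-1})$. It starts at $w_0$ and ends at $\mathrm{end}(\gamma)=w_n$. $\mathcal{P}(w,\boldsymbol{v})_u$ is the set of pointed pregalleries of type $\boldsymbol{v}$ starting at $w$ and ending at $u$. For such $\gamma$ and $s\in S$ let $\alpha_s(\gamma)=|\{j:s_j=s,\ \ell(w_{j-1})<\ell(w_j)\}|$, $\sigma_s(\gamma)=|\{j:s_j=s,\ w_j=w_{j-1}\}|$, and $q(\gamma)=\prod_{s\in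 S}q_s^{\alpha_s(\gamma)}(q_s-1)^{\sigma_s(\gamma)}$. *)

(* Defs.v *)
From mathcomp Require Import all_boot ssralg.
From mathcomp Require Import boolp classical_sets functions cardinality fsbigop.

Set Implicit Arguments.
Unset Strict Implicit.
Unset Printing Implicit Defensive.

Local Open Scope classical_set_scope.
Local Open Scope card_scope.
Local Open Scope group_scope.

(** The finite set [S] is a [finType] together with the inclusion map
    [r : S -> W]. *)

Section Coxeter.
Variables (W : groupType) (S : finType) (r : S -> W).

(* The value 0 encodes m(s,t) = infinity. *)
Record coxeter_matrix (m : S -> S -> nat) : Prop := CoxeterMatrix {
  cm_diag : forall s, m s s = 1%N;
  cm_sym : forall s t, m s t = m t s;
  cm_offdiag : forall s t, s != t -> m s t != 1%N }.

(* When m s t = 0 the relation reads 1 = 1, i.e., there is no relation. *)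
Definition coxeter_relations (m : S -> S -> nat) (G : groupType) (f : S -> G) :=
  forall s t, (f s * f t) ^+ m s t = 1.

(* W = < S | (st)^m(s,t) = 1 >, expressed by the universal property of a group
   presentation. Since the generators are involutions, generation can be stated
   with words in S, without inverses. *)
Record coxeter_system : Prop := CoxeterSystem {
  cox_inj : injective r;
  cox_gen : forall w : W, exists ss : seq S, \prod_(s <- ss) r s = w;
  cox_pres : exists2 m, coxeter_matrix m &
    coxeter_relations m r /\
    forall (G : groupType) (f : S -> G), coxeter_relations m f ->
      exists phi : {multiplicative W -> G}, forall s, phi (r s) = f s }.

Definition has_expression (w : W) (n : nat) : bool :=
  `[< exists2 ss : seq S, size ss = n & \prod_(s <- ss) r s = w >].

(* The value 0 outside the subgroup generated by S is irrelevant for Coxeter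
   systems. *)
Definition cox_length (w : W) : nat :=
  if pselect (exists n, has_expression w n) is left e then ex_minn e else 0%N.

Definition reduced_expression (ss : seq S) (v : W) : Prop :=
  \prod_(s <- ss) r s = v /\ size ss = cox_length v.

End Coxeter.

Section Building.
Variables (W : groupType) (S : finType) (r : S -> W).
Variables (C : Type) (delta : C -> C -> W).

Local Notation len := (cox_length r).

(* Buildings as W-metric spaces. *)
Record building : Prop := Building {
  bd_nonempty : exists c : C, True;
  bd_eq : forall c d, delta c d = 1 <-> c = d;
  bd_step : forall c c' d s, delta c' c = r s ->
    delta c' d = r s * delta c d \/ delta c' d = delta c d;
  bd_up : forall c c' d s, delta c' c = r s ->
    len (r s * delta c d) = (len (delta c d)).+1 ->
    delta c' d = r s * delta c d;
  bd_ex : forall c d s, exists2 c', delta c' c = r s &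
    delta c' d = r s * delta c d }.

(* The chambers lying on the panel of c of cotype {s}. *)
Definition panel (s : S) (c : C) : set C :=
  [set d | delta c d = 1 \/ delta c d = r s].

(* Local finiteness is the finiteness of the parameters q s. *)
Definition regular (q : S -> nat) : Prop :=
  forall s c, panel s c #= `I_(q s).+1.

Definition sphere (x : W) (c : C) : set C := [set d | delta c d = x].

(* is_structure_constant u v w N means that c_{u,v}^w is well defined and
   equal to N. *)
Definition is_structure_constant (u v w : W) (N : nat) : Prop :=
  (exists a b, delta a b = w) /\
  forall a b, delta a b = w -> sphere u a `&` sphere v b #= `I_N.

Lemma is_structure_constant_unique (u v w : W) (N N' : nat) :
  is_structure_constant u v w N -> is_structure_constant u v w N' -> N = N'.
Proof.
move=> [[a [b ab]] /(_ a b ab) hN] [_ /(_ a b ab) hN'].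
by apply/card_eq_II; apply: card_eq_trans hN'; rewrite card_eq_sym.
Qed.

End Building.

Section Pregallery.
Variables (W : groupType) (S : finType) (r : S -> W).

Local Notation len := (cox_length r).

(* (w_0, s_1, w_1, ..., s_n, w_n) is encoded as
   (w_0, [:: (s_1, w_1); ...; (s_n, w_n)]). *)
Definition pregallery := (W * seq (S * W))%type.

Fixpoint steps_from (x : W) (l : seq (S * W)) : seq (W * S * W) :=
  if l is (s, y) :: l' then (x, s, y) :: steps_from y l' else [::].

(* The sequence of triples (w_{j-1}, s_j, w_j), 1 <= j <= n. *)
Definition pg_steps (g : pregallery) : seq (W * S * W) := steps_from g.1 g.2.

Definition pg_type (g : pregallery) : seq S := map fst g.2.
Definition pg_start (g : pregallery) : W := g.1.
Definition pg_end (g : pregallery) : W := last g.1 (map snd g.2).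

Definition valid_step (p : W * S * W) : bool :=
  let: (x, s, y) := p in
  ((y == x) || (y == x * r s)) && ((x == y) ==> (len (x * r s) < len x)%N).

Definition is_pregallery (g : pregallery) : bool := all valid_step (pg_steps g).

Definition pregalleries (w : W) (ss : seq S) (u : W) : set pregallery :=
  [set g | [/\ is_pregallery g, pg_type g = ss, pg_start g = w & pg_end g = u]].

Definition pg_alpha (s : S) (g : pregallery) : nat :=
  count (fun p : W * S * W => let: (x, t, y) := p in
    (t == s) && (len x < len y)%N) (pg_steps g).

Definition pg_sigma (s : S) (g : pregallery) : nat :=
  count (fun p : W * S * W => let: (x, t, y) := p in (t == s) && (y == x))
    (pg_steps g).

(* Natural number subtraction is harmless: q s >= 1 in a regular building. *)
Definition pg_weight (q : S -> nat) (g : pregallery) : nat :=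
  (\prod_(s : S) (q s ^ pg_alpha s g * (q s - 1) ^ pg_sigma s g))%N.

(* The sum over [pregalleries w ss u] below is a finitely supported sum; this
   lemma shows that it ranges over a finite set. *)
Lemma finite_pregalleries (w : W) (ss : seq S) (u : W) :
  finite_set (pregalleries w ss u).
Proof.
suff [L hL] : exists L : seq pregallery, forall g : pregallery,
    is_pregallery g -> pg_type g = ss -> pg_start g = w -> g \in L.
  apply: (sub_finite_set (B := [set` L])); last exact: finite_seq.
  by move=> g [h1 h2 h3 _]; exact: hL.
elim: ss w => [|s ss IH] w.
  exists [:: (w, [::])] => -[w0 [|//]] _ _.
  by rewrite /pg_start /= => ->; rewrite inE.
have [L1 h1] := IH w; have [L2 h2] := IH (w * r s).
exists [seq (w, (s, g.1) :: g.2) | g <- L1 ++ L2] => -[w0 [//|[t y] l]].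
rewrite /is_pregallery /pg_type /pg_start /= => /andP[/andP[hy _] hl] [ts hs] ww.
rewrite {w0}ww {t}ts in hy *.
apply/mapP; exists (y, l) => //; rewrite mem_cat.
by case/orP: hy => /eqP yE; apply/orP; [left; apply: h1 | right; apply: h2].
Qed.

End Pregallery.

(* Main.v *)
(** If [v = s v'] with lengths adding, the chambers [d] with [delta b d = v]
    are partitioned according to the unique chamber [c] with [delta b c = s]
    and [delta c d = v']. Seen from [a], with [delta a b = w], either [ws] is
    longer than [w] and all [q_s] such chambers [c] are at distance [ws], or
    [ws] is shorter, exactly one of them is at distance [ws] and the other
    [q_s - 1] are at distance [w]. Hence the structure constants satisfy the
    recursion obtained for the weighted sum over pregalleries by splitting off
    the first step. *)

Require Import Defs.
From mathcomp Require Import all_boot ssralg perm.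
From mathcomp Require Import boolp classical_sets functions cardinality fsbigop.

Set Implicit Arguments.
Unset Strict Implicit.
Unset Printing Implicit Defensive.

Local Open Scope classical_set_scope.
Local Open Scope card_scope.
Local Open Scope group_scope.

(** * Length and parity in a Coxeter system *)

Section CoxeterLength.
Variables (W : groupType) (S : finType) (r : S -> W).
Hypothesis HW : coxeter_system r.

Local Notation len := (cox_length r).

Lemma gen_mulgg s : r s * r s = 1.
Proof.
have [m mP [rel _]] := cox_pres HW.
by have := rel s s; rewrite (cm_diag mP).
Qed.

Lemma gen_invg s : (r s)^-1 = r s.
Proof. by rewrite -[LHS]mulg1 -(gen_mulgg s) mulKg. Qed.

Lemma gen_mulK s x : r s * (r s * x) = x.
Proof. by rewrite mulgA gen_mulgg mul1g. Qed.

Lemma gen_mulgK x s : x * r s * r s = x.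
Proof. by rewrite -mulgA gen_mulgg mulg1. Qed.

Lemma prod_gen_rev ss :
  \prod_(s <- rev ss) r s = (\prod_(s <- ss) r s)^-1.
Proof.
elim: ss => [|s ss IH]; first by rewrite !big_nil invg1.
by rewrite rev_cons -cats1 big_cat big_seq1 IH big_cons invgM gen_invg.
Qed.

Lemma cox_length_prod_le ss : (len (\prod_(s <- ss) r s) <= size ss)%N.
Proof.
rewrite /cox_length; case: pselect => [e|[]].
  by case: ex_minnP => m _; apply; apply/asboolP; exists ss.
by exists (size ss); apply/asboolP; exists ss.
Qed.

Lemma reduced_expression_exists w : exists ss, reduced_expression r ss w.
Proof.
rewrite /reduced_expression /cox_length; case: pselect => [e|[]].
  by case: ex_minnP => m /asboolP[ss ? ?] _; exists ss.
have [ss ssw] := cox_gen HW w.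
by exists (size ss); apply/asboolP; exists ss.
Qed.

Lemma cox_lengthV w : len w^-1 = len w.
Proof.
have leV x : (len x^-1 <= len x)%N.
  have [ss [<- <-]] := reduced_expression_exists x.
  by rewrite -prod_gen_rev -(size_rev ss) cox_length_prod_le.
by apply/eqP; rewrite eqn_leq leV -{1}[w]invgK leV.
Qed.

Lemma cox_length_gen_mul_le s w : (len (r s * w) <= (len w).+1)%N.
Proof.
have [ss [<- <-]] := reduced_expression_exists w.
by have := cox_length_prod_le (s :: ss); rewrite big_cons.
Qed.

(* Sending every generator to a transposition respects the Coxeter relations,
   so the parity of a word depends only on the element it represents. *)
Lemma odd_size_prod ss :
  odd (size ss) = odd (len (\prod_(s <- ss) r s)).
Proof.
have [m _ [_ univ]] := cox_pres HW.
have [|phi phiE] := univ {perm bool} (fun=> tperm true false).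
  by move=> s t; rewrite tperm2 expg1n.
have par tt : odd (size tt) = phi (\prod_(s <- tt) r s).
  elim: tt => [|s tt IH]; last first.
    by rewrite big_cons gmulfM odd_permM phiE odd_tperm /= IH.
  rewrite big_nil /=; apply/esym.
  (* Writing 1 as 1 * 1 adds the parity of [phi 1] to itself, so it is even. *)
  by rewrite -[1 in LHS]mulg1 gmulfM odd_permM addbb.
have [tt [ttE <-]] := reduced_expression_exists (\prod_(s <- ss) r s).
by rewrite !par ttE.
Qed.

Lemma odd_cox_length_gen_mul s w : odd (len (r s * w)) = ~~ odd (len w).
Proof.
have [ss [<- <-]] := reduced_expression_exists w.
by have := odd_size_prod (s :: ss); rewrite big_cons => <-.
Qed.

(** Since [r s] is an involution, the upper bound applies in both directions and the length changes
    by at most one; parity excludes equality. *)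
Lemma cox_length_gen_mul s w :
  len (r s * w) = (len w).+1 \/ len w = (len (r s * w)).+1.
Proof.
have le1 := cox_length_gen_mul_le s w.
have le2 := cox_length_gen_mul_le s (r s * w); rewrite gen_mulK in le2.
have := odd_cox_length_gen_mul s w.
case: (ltngtP (len (r s * w)) (len w)) => [lt|lt|->] par.
- by right; apply/eqP; rewrite eqn_leq le2.
- by left; apply/eqP; rewrite eqn_leq le1.
- by case: (odd _) par.
Qed.

Lemma cox_length_mul_gen w s : len (w * r s) = len (r s * w^-1).
Proof. by rewrite -cox_lengthV invgM gen_invg. Qed.

Lemma ltn_cox_length_mul_gen w s :
  (len w < len (w * r s))%N = ~~ (len (w * r s) < len w)%N.
Proof.
rewrite -leqNgt ltn_neqAle andb_idl // => _; apply/eqP => /(congr1 odd).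
rewrite cox_length_mul_gen odd_cox_length_gen_mul cox_lengthV.
by case: odd.
Qed.

Lemma gen_neq1 s : r s != 1.
Proof.
apply/eqP => r1; have := odd_cox_length_gen_mul s 1.
by rewrite r1 mulg1; case: odd.
Qed.

Lemma mul_gen_neq w s : w * r s != w.
Proof. by rewrite -{2}[w]mulg1 (can_eq (mulKg w)) gen_neq1. Qed.

(** A shorter expression of the tail would, with [s] prepended, shorten the whole word. *)
Lemma reduced_expression_cons s ss v :
  reduced_expression r (s :: ss) v ->
  reduced_expression r ss (r s * v) /\ len v = (len (r s * v)).+1.
Proof.
rewrite /reduced_expression big_cons /= => -[<- sz]; rewrite gen_mulK.
have le1 := cox_length_gen_mul_le s (\prod_(t <- ss) r t).
have le2 := cox_length_prod_le ss.
suff -> : len (\prod_(t <- ss) r t) = size ss by [].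
by apply/eqP; rewrite eqn_leq le2 -ltnS sz.
Qed.

End CoxeterLength.

(** * Galleries, symmetry of the Weyl distance, and panels *)

Section WeylDistance.
Variables (W : groupType) (S : finType) (r : S -> W).
Hypothesis HW : coxeter_system r.
Variables (C : Type) (delta : C -> C -> W).
Hypothesis HX : building r delta.

Local Notation len := (cox_length r).

Lemma delta_refl c : delta c c = 1.
Proof. exact/(bd_eq HX). Qed.

Lemma delta_gen_sym c d s : delta c d = r s -> delta d c = r s.
Proof.
move=> cd; case: (bd_step HX c cd) => /esym; rewrite delta_refl.
  by move/(congr1 (fun x => r s * x)); rewrite (gen_mulK HW) mulg1.
move/(bd_eq HX) => dc; move: cd.
by rewrite dc delta_refl => /esym/eqP; rewrite (negPf (gen_neq1 HW s)).
Qed.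

Fixpoint gallery (ss : seq S) (a b : C) : Prop :=
  if ss is s :: ss' then exists2 c, delta a c = r s & gallery ss' c b
  else a = b.

Lemma gallery_rev ss a b : gallery ss a b -> gallery (rev ss) b a.
Proof.
have catg tt tt' x y z :
    gallery tt x y -> gallery tt' y z -> gallery (tt ++ tt') x z.
  elim: tt x => [x ->//|t tt IH x [x' xx' x'y] yz].
  by exists x' => //; exact: IH.
elim: ss a => [a ->//|s ss IH a [c ac cb]]; rewrite rev_cons -cats1.
apply: catg (IH _ cb) _.
by exists a => //; exact: delta_gen_sym.
Qed.

Lemma gallery_exists ss a b : delta a b = \prod_(s <- ss) r s -> gallery ss a b.
Proof.
elim: ss a => [a|s ss IH a ab]; first by rewrite big_nil => /(bd_eq HX).
have [c ca cb] := bd_ex HX a b s; exists c; first exact: delta_gen_sym.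
by apply: IH; rewrite cb ab big_cons (gen_mulK HW).
Qed.

(** Tails of a reduced word are reduced, so each letter increases the length and [bd_up] determines
    the distance step by step. *)
Lemma delta_reduced_gallery ss a b v :
  reduced_expression r ss v -> gallery ss a b -> delta a b = v.
Proof.
elim: ss a v => [a v [<- _] ->|s ss IH a v red [c ac cb]].
  by rewrite big_nil delta_refl.
have [red' lenv] := reduced_expression_cons HW red.
have {}cb := IH _ _ red' cb.
by rewrite (bd_up HX ac) ?cb ?(gen_mulK HW).
Qed.

(** The building axioms move only the first argument of [delta]; this symmetry transfers them to the
    second. A gallery from [a] to [b] along a reduced word, read backwards, has a reduced type
    representing the inverse. *)
Lemma delta_sym a b : delta b a = (delta a b)^-1.
Proof.
have [ss [ssE szE]] := reduced_expression_exists HW (delta a b).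
have red : reduced_expression r (rev ss) (delta a b)^-1.
  by split; rewrite ?(prod_gen_rev HW) ?ssE // size_rev szE (cox_lengthV HW).
exact: delta_reduced_gallery red (gallery_rev (gallery_exists (esym ssE))).
Qed.

(** Keeps the quantification over pairs at distance [w] from being vacuous, as
    [is_structure_constant] demands. *)
Lemma delta_surj w : exists a b, delta a b = w.
Proof.
have [b _] := bd_nonempty HX; suff [a ab] : exists a, delta a b = w.
  by exists a, b.
have [ss <-] := cox_gen HW w.
elim: ss => [|s ss [a ab]]; first by exists b; rewrite big_nil delta_refl.
by have [c _ cb] := bd_ex HX a b s; exists c; rewrite cb ab big_cons.
Qed.

Lemma delta_up_right a b c s : delta b c = r s ->
  (len (delta a b) < len (delta a b * r s))%N -> delta a c = delta a b * r s.
Proof.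
move=> /delta_gen_sym cb.
rewrite (cox_length_mul_gen HW) -(delta_sym a b) -(cox_lengthV HW).
rewrite -(delta_sym a b) => lt; rewrite (delta_sym c a) (bd_up HX cb).
  by rewrite invgM (gen_invg HW) -delta_sym.
case: (cox_length_gen_mul HW s (delta b a)) => // eq1.
by move: lt; rewrite eq1 ltnNge leqnSn.
Qed.

(** [bd_step] leaves only the distances 1 and [r s], and 1 would mean [c = d]. *)
Lemma delta_panel s b c d :
  delta b c = r s -> delta b d = r s -> c <> d -> delta c d = r s.
Proof.
move=> /delta_gen_sym cb bd cd; case: (bd_step HX d cb); rewrite bd //.
by rewrite (gen_mulgg HW) => /(bd_eq HX).
Qed.

(* The projection of [a] onto the panel of [b]: it is unique, and the other
   chambers of the panel are all at distance [delta a b] from [a]. *)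
Lemma delta_down_right a b s :
  (len (delta a b * r s) < len (delta a b))%N ->
  exists2 c0, delta b c0 = r s /\ delta a c0 = delta a b * r s &
    forall c, delta b c = r s -> c <> c0 -> delta a c = delta a b.
Proof.
move=> lt; have [c0 c0b c0a] := bd_ex HX b a s.
have ac0 : delta a c0 = delta a b * r s.
  by rewrite (delta_sym c0 a) c0a invgM (gen_invg HW) -delta_sym.
have bc0 := delta_gen_sym c0b.
exists c0 => // c bc cc0.
have c0c : delta c0 c = r s by apply: (delta_panel bc0 bc) => /esym.
(* From [c0] the length goes up along the panel, so any other chamber [c] is at distance (w s) s = w
   from [a]. *)
by rewrite (delta_up_right c0c) ac0 (gen_mulgK HW).
Qed.

Lemma sphere_gen_mul s v b : len v = (len (r s * v)).+1 ->
  sphere delta v b =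
  \bigcup_(c in sphere delta (r s) b) sphere delta (r s * v) c.
Proof.
move=> lenv; apply/seteqP; split=> d; rewrite /sphere /=.
  move=> bd; have [c cb cd] := bd_ex HX b d s; exists c => /=.
    exact: delta_gen_sym.
  by rewrite cd bd.
by move=> [c /= bc cd]; rewrite (bd_up HX bc) cd (gen_mulK HW).
Qed.

(** Distinct [c] and [c'] would be s-adjacent; [bd_up] would then give [delta c d = v], whereas it
    is [r s * v], of smaller length. *)
Lemma disjoint_sphere_gen_mul s v b : len v = (len (r s * v)).+1 ->
  forall c c' d, delta b c = r s -> delta b c' = r s ->
  sphere delta (r s * v) c d -> sphere delta (r s * v) c' d -> c = c'.
Proof.
rewrite /sphere /= => lenv c c' d bc bc' cd c'd; apply: contrapT => cc'.
have := bd_up HX (delta_panel bc bc' cc') (d := d).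
rewrite c'd cd (gen_mulK HW) lenv => /(_ erefl) /(congr1 len)/eqP.
by rewrite lenv -[X in X == _]addn0 -addn1 eqn_add2l.
Qed.

End WeylDistance.

(** * Cardinalities of disjoint unions *)

Section Counting.

Lemma card_setU_II T (A B : set T) m n : A `&` B = set0 ->
  A #= `I_m -> B #= `I_n -> A `|` B #= `I_(m + n).
Proof.
elim: m A => [|m IH] A AB0 Am Bn.
  by move: Am; rewrite II0 card_eq0 => /eqP ->; rewrite set0U.
have /eq_cardSP[x Ax Axm] := Am.
rewrite addSn; apply/eq_cardSP; exists x; first by left.
have -> : (A `|` B) `\ x = A `\ x `|` B.
  rewrite setDUl; congr (_ `|` _); apply: not_setD1 => Bx.
  by have : (A `&` B) x by []; rewrite AB0.
apply: IH => //; apply/seteqP; split=> // y [[Ay _] By].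
by rewrite -AB0.
Qed.

Lemma card_setD1_II T (A : set T) x n : A x ->
  A #= `I_n.+1 -> A `\ x #= `I_n.
Proof.
move=> Ax An; have [k Dk] : finite_set (A `\ x).
  by apply: finite_setD; exists n.+1.
(* Putting [x] back gives 1 + k = n + 1. *)
suff -> : n = k by [].
have := card_setU_II (setDIK [set x] A) card_set1 Dk.
rewrite setDUK; last by move=> _ ->.
by rewrite (card_eql An) => /card_eq_II[].
Qed.

Lemma card_bigcup_II T I (A : set I) (F : I -> set T) m n :
  (forall i j x, A i -> A j -> F i x -> F j x -> i = j) ->
  A #= `I_m -> (forall i, A i -> F i #= `I_n) ->
  \bigcup_(i in A) F i #= `I_(m * n)%N.
Proof.
elim: m A => [|m IH] A disj Am Fn.
  by move: Am; rewrite II0 !card_eq0 => /eqP ->; rewrite bigcup_set0.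
have /eq_cardSP[x Ax Axm] := Am.
rewrite mulSn (bigcup_setD1 x) //; apply: card_setU_II; last 1 first.
- by apply: IH => // [i j y [Ai _] [Aj _]|i [Ai _]]; [exact: disj | exact: Fn].
- apply/seteqP; split=> // y [Fx [i [Ai ix] Fi]].
  by apply: ix; apply: disj Fi Fx.
- exact: Fn.
Qed.

End Counting.

(** * Recursion for the weighted sum over pregalleries *)

Section PregallerySum.
Variables (W : groupType) (S : finType) (r : S -> W).
Hypothesis HW : coxeter_system r.
Variable q : S -> nat.

Local Notation len := (cox_length r).
Local Notation weight := (pg_weight r q).
Local Notation pgsum w ss u :=
  (\sum_(g \in pregalleries r w ss u) weight g)%R.

Definition pg_cons (w : W) (s : S) (g : pregallery W S) : pregallery W S :=
  (w, (s, g.1) :: g.2).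

Lemma pg_cons_inj w s : injective (pg_cons w s).
Proof. by move=> [x l] [y l'] [-> ->]. Qed.

(** With booleans as exponents, the first step contributes [q s] when it ascends, [q s - 1] when it
    stays, and 1 otherwise. *)
Lemma pg_weight_cons w s g :
  weight (pg_cons w s g) =
  (q s ^ (len w < len g.1) * (q s - 1) ^ (g.1 == w) * weight g)%N.
Proof.
rewrite /pg_weight (bigD1 s) //= [in RHS](bigD1 s) //=.
rewrite /pg_alpha /pg_sigma /= eqxx /= !expnD.
rewrite mulnACA -!mulnA; congr (_ * (_ * (_ * (_ * _))))%N.
by apply: eq_bigr => t /negPf ts; rewrite eq_sym ts.
Qed.

(** The first step moves to [w * r s] or stays at [w]; staying is allowed only at a descent. *)
Lemma pregalleries_cons w s ss u :
  pregalleries r w (s :: ss) u =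
  pg_cons w s @` pregalleries r (w * r s) ss u `|`
  (if (len (w * r s) < len w)%N then pg_cons w s @` pregalleries r w ss u
   else set0).
Proof.
apply/seteqP; split.
  move=> [x [|[t y] l]] [] //; rewrite /is_pregallery /pg_type /pg_start /pg_end.
  move=> /= /andP[/andP[/orP[]/eqP-> /implyP lt] pl] [<- lss] xw; subst x.
    by move=> lu; right; rewrite lt //; exists (w, l).
  by move=> lu; left; exists (w * r t, l).
rewrite subUset; split.
  move=> _ [g [pg gss gw gu] <-]; split; rewrite /pg_type /= -?gss //.
  rewrite /pg_start in gw; rewrite /is_pregallery /= gw eqxx orbT eq_sym.
  by rewrite (negPf (mul_gen_neq HW w s)) -gw.
case: ifP => // lt _ [g [pg gss gw gu] <-].
split; rewrite /pg_type /= -?gss //.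
rewrite /pg_start in gw; rewrite /is_pregallery /= gw eqxx lt.
by rewrite -[X in all _ (steps_from X _)]gw.
Qed.

Lemma pregalleries_nil w u :
  pregalleries r w [::] u = if w == u then [set (w, [::])] else set0.
Proof.
apply/seteqP; split.
  move=> [x [|p l]] [] //; rewrite /pg_start /pg_end /= => _ _ -> ->.
  by rewrite eqxx.
by move=> g; case: eqP => //= <- ->.
Qed.

Lemma pgsum_nil w u : pgsum w [::] u = (w == u).
Proof.
rewrite pregalleries_nil; case: eqP => _; last by rewrite fsbig_set0.
by rewrite fsbig_set1 /pg_weight big1.
Qed.

Lemma fsbig_pg_cons w s x ss u :
  (\sum_(g \in pg_cons w s @` pregalleries r x ss u) weight g)%R =
  (q s ^ (len w < len x) * (q s - 1) ^ (x == w) * pgsum x ss u)%N.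
Proof.
rewrite fsbig_image; last by move=> ? ? _ _; exact: pg_cons_inj.
rewrite fsbig_distrr; last exact: finite_pregalleries.
apply: eq_fsbigr => g; rewrite inE => -[_ _ gx _].
by rewrite pg_weight_cons -gx.
Qed.

Lemma pgsum_cons w s ss u :
  pgsum w (s :: ss) u =
  if (len (w * r s) < len w)%N then
    (pgsum (w * r s) ss u + (q s - 1) * pgsum w ss u)%N
  else (q s * pgsum (w * r s) ss u)%N.
Proof.
have ws := negPf (mul_gen_neq HW w s).
rewrite pregalleries_cons; case: ifP => lt; last first.
  rewrite setU0 fsbig_pg_cons ws expn0 muln1.
  by rewrite (ltn_cox_length_mul_gen HW) lt expn1.
rewrite fsbigU0; last first.
(* A pregallery in both images would have a tail starting at both [w * r s] and [w]. *)
- move=> _ [[g [_ _ gw _] <-] [g' [_ _ g'w _] /pg_cons_inj gg']].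
  by move/eqP: ws; apply; rewrite -gw -g'w gg'.
- exact/finite_image/finite_pregalleries.
- exact/finite_image/finite_pregalleries.
rewrite !fsbig_pg_cons ws eqxx ltnn (ltn_cox_length_mul_gen HW) lt /=.
by rewrite !expn0 expn1 !mul1n.
Qed.

End PregallerySum.

(** * Structure constants by induction on the reduced word *)

Section StructureConstants.
Variables (W : groupType) (S : finType) (r : S -> W).
Hypothesis HW : coxeter_system r.
Variables (C : Type) (delta : C -> C -> W).
Hypothesis HX : building r delta.
Variable q : S -> nat.
Hypothesis Hq : regular r delta q.

Lemma card_sphere_gen s b : sphere delta (r s) b #= `I_(q s).
Proof.
have -> : sphere delta (r s) b = panel r delta s b `\ b.
  apply/seteqP; rewrite /sphere /panel; split=> c /=.
    move=> bc; split; first by right.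
    move=> cb; move: bc; rewrite cb (delta_refl HX) => /esym/eqP.
    by rewrite (negPf (gen_neq1 HW s)).
  by move=> [[/(bd_eq HX) ->|bc] nbc] //; case: nbc.
by apply: card_setD1_II (Hq s b); left; exact: delta_refl HX _.
Qed.

(** The induction keeps [a] fixed and varies [b]: replacing [b] by a chamber [c] of its s-panel
    changes [delta a b] exactly as a first pregallery step does. *)
Lemma card_sphereI u v vs a b : reduced_expression r vs v ->
  sphere delta u a `&` sphere delta v b #=
  `I_(\sum_(g \in pregalleries r (delta a b) vs u) pg_weight r q g)%R.
Proof.
elim: vs v b => [|s vs IH] v b red.
  have -> : sphere delta v b = [set b].
    case: red => <- _; rewrite big_nil /sphere.
    by apply/seteqP; split=> c /=; rewrite (bd_eq HX) => ->.
  rewrite pgsum_nil setI1; case: eqVneq => [ab|/eqP nab].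
    by rewrite mem_set //; exact: card_set1.
  by rewrite memNset // II0 card_eq0.
have [red' lenv] := reduced_expression_cons HW red.
rewrite (sphere_gen_mul HW HX b lenv) setI_bigcupr.
set F := fun c => sphere delta u a `&` sphere delta (r s * v) c.
have disj c c' d : sphere delta (r s) b c -> sphere delta (r s) b c' ->
    F c d -> F c' d -> c = c'.
  move=> bc bc' [_ cd] [_ c'd].
  exact: (disjoint_sphere_gen_mul HW HX lenv bc bc' cd c'd).
rewrite (pgsum_cons HW); case: ifP => lt.
  have [c0 [bc0 ac0] others] := delta_down_right HW HX lt.
  (* The projection [c0] accounts for the moving step, the remaining chambers for the staying
     step. *)
  rewrite (bigcup_setD1 c0) //; apply: card_setU_II.
  - apply/seteqP; split=> // d [c0d [c [bc cc0] cd]].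
    by apply: cc0; apply: disj cd c0d.
  - by rewrite -ac0; exact: IH.
  - apply: card_bigcup_II.
    + by move=> c c' d [bc _] [bc' _]; exact: disj.
    + apply: card_setD1_II => //.
      (* The truncated subtraction is exact: [c0] lies in a set of [q s] chambers, so [q s] is
         positive. *)
      suff -> : (q s - 1).+1 = q s by exact: card_sphere_gen.
      case: (q s) (card_sphere_gen s b) => [|n _]; last by rewrite subn1.
      rewrite II0 card_eq0 => /eqP s0.
      by have : sphere delta (r s) b c0 by []; rewrite s0.
    + by move=> c [bc cc0]; rewrite -(others c bc cc0); exact: IH.
(* At an ascent all [q s] chambers are at distance w s from [a], so the pieces have equal size. *)
apply: card_bigcup_II => //; first exact: card_sphere_gen.
move=> c bc; rewrite -(delta_up_right HW HX bc); first exact: IH.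
by rewrite (ltn_cox_length_mul_gen HW) lt.
Qed.

End StructureConstants.

Local Open Scope ring_scope.

Theorem theorem3p6 (W : groupType) (S : finType) (r : S -> W)
    (HW : coxeter_system r)
    (C : Type) (delta : C -> C -> W) (HX : building r delta)
    (q : S -> nat) (Hq : regular r delta q)
    (u v w : W) (vs : seq S) (Hv : reduced_expression r vs v) :
  is_structure_constant delta u v w
    (\sum_(g \in pregalleries r w vs u) pg_weight r q g).
Proof.
split; first exact: (delta_surj HW HX).
by move=> a b <-; exact: (card_sphereI HW HX Hq).
Qed.
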